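(* Let $\frac{d\bm{x}}{dt}=\bm{F}(\bm{x},t)$ be a (possibly non-autonomous) dynamical system, with $\bm{F}:\mathbb{R}^N\times\mathbb{R}\to\mathbb{R}^N$ continuously differentiable in $\bm{x}$, and let $\mathcal{K}$ and $\mathcal{P}$ be its Koopman and Perron--Frobenius generators. Let $U\subseteq\mathbb{R}^N$ be open and let $u_1,u_2:U\to\mathbb{C}$ be continuously differentiable Perron--Frobenius eigenfunctions of $\mathcal{P}$ with corresponding eigenvalues $\lambda_1,\lambda_2\in\mathbb{C}$, with $u_1$ nowhere vanishing on $U$. Then the ratio $u_2/u_1$ is a Koopman eigenfunction of $\mathcal{K}$ with eigenvalue $\lambda_1-\lambda_2$, i.e. $$\mathcal{K}\left(\frac{u_2}{u_1}\right)=(\lambda_1-\lambda_2)\,\frac{u_2}{u_1}.$$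
   Context: For $\frac{d\bm{x}}{dt}=\bm{F}(\bm{x},t)$, the Koopman generator acts on a continuously differentiable function $u$ by $(\mathcal{K}u)(\bm{x})=\bm{F}(\bm{x},t)\cdot\nabla u(\bm{x})$, and the Perron--Frobenius (Liouville) generator acts by $(\mathcal{P}v)(\bm{x})=-\nabla\cdot(\bm{F}(\bm{x},t)v(\bm{x}))$. Both operators generally depend on $t$. A Koopman eigenfunction with eigenvalue $\lambda\in\mathbb{C}$ is a function $u$, not identically zero, with $\mathcal{K}u=\lambda u$ (for all $t$); a Perron--Frobenius eigenfunction with eigenvalue $\mu\in\mathbb{C}$ is a function $v$, not identically zero, with $\mathcal{P}v=\mu v$ (for all $t$). *)

(* Defs.v *)
From mathcomp Require Export all_boot all_order all_algebra.
From mathcomp Require Export all_classical all_reals all_analysis.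
From mathcomp.real_closed Require Export complex.

Set Implicit Arguments.
Unset Strict Implicit.
Unset Printing Implicit Defensive.

Import Order.TTheory GRing.Theory Num.Theory.
Export numFieldNormedType.Exports.

Local Open Scope classical_set_scope.
Local Open Scope ring_scope.
Local Open Scope complex_scope.

(* Functions on an open set U are encoded as total functions that are only
   constrained on U: all the notions below are local, so at a point of U they
   depend only on the values on U. *)

Definition partial (R : realType) (N : nat) (W : normedModType R)
    (i : 'I_N) (f : 'rV[R]_N -> W) (x : 'rV[R]_N) : W :=
  'D_(delta_mx 0 i) f x.

Definition C1_on (R : realType) (N : nat) (W : normedModType R)
    (U : set 'rV[R]_N) (f : 'rV[R]_N -> W) : Prop :=
  (forall x, U x -> differentiable f x) /\
  (forall i x, U x -> {for x, continuous (partial i f)}).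

(* R[i] carries no normed R-module structure, so real differentiation of
   complex-valued functions goes through the real and imaginary parts. *)

Definition C1C_on (R : realType) (N : nat)
    (U : set 'rV[R]_N) (u : 'rV[R]_N -> R[i]) : Prop :=
  C1_on U (fun x => complex.Re (u x)) /\ C1_on U (fun x => complex.Im (u x)).

Definition cpartial (R : realType) (N : nat)
    (i : 'I_N) (u : 'rV[R]_N -> R[i]) (x : 'rV[R]_N) : R[i] :=
  partial i (fun y => complex.Re (u y)) x +i*
  partial i (fun y => complex.Im (u y)) x.

Definition koopman (R : realType) (N : nat)
    (F : 'rV[R]_N -> R -> 'rV[R]_N) (t : R)
    (u : 'rV[R]_N -> R[i]) (x : 'rV[R]_N) : R[i] :=
  \sum_(i < N) (F x t 0 i)%:C * cpartial i u x.

Definition perron_frobenius (R : realType) (N : nat)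
    (F : 'rV[R]_N -> R -> 'rV[R]_N) (t : R)
    (v : 'rV[R]_N -> R[i]) (x : 'rV[R]_N) : R[i] :=
  - \sum_(i < N) cpartial i (fun y => (F y t 0 i)%:C * v y) x.

(* Eigenfunctions do not depend on t, and one eigenvalue serves for all t. *)

Definition koopman_eigenfunction (R : realType) (N : nat)
    (F : 'rV[R]_N -> R -> 'rV[R]_N) (U : set 'rV[R]_N)
    (lambda : R[i]) (u : 'rV[R]_N -> R[i]) : Prop :=
  [/\ C1C_on U u,
      exists2 x, U x & u x != 0 &
      forall t x, U x -> koopman F t u x = lambda * u x].

Definition perron_frobenius_eigenfunction (R : realType) (N : nat)
    (F : 'rV[R]_N -> R -> 'rV[R]_N) (U : set 'rV[R]_N)
    (mu : R[i]) (v : 'rV[R]_N -> R[i]) : Prop :=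
  [/\ C1C_on U v,
      exists2 x, U x & v x != 0 &
      forall t x, U x -> perron_frobenius F t v x = mu * v x].

(* Main.v *)
Require Import Defs.
From mathcomp Require Import ring.
Import Order.TTheory GRing.Theory Num.Theory.

(** With w = u2 / u1 and D = div F (.,t), the Leibniz rule gives
    P u = - D u - K u for every differentiable u.  Since u2 = w u1 and K is a
    derivation,
      - (lambda2 + D) u2 = K u2 = u1 K w + w K u1 = u1 K w - (lambda1 + D) u2,
    so the divergence cancels and u1 K w = (lambda1 - lambda2) w u1. *)

Local Open Scope classical_set_scope.
Local Open Scope ring_scope.
Local Open Scope complex_scope.

Section RealC1.
Set Implicit Arguments.
Unset Strict Implicit.
Variables (R : realType) (N : nat).
Implicit Types (U : set 'rV[R]_N) (f g : 'rV[R]_N -> R) (x : 'rV[R]_N).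

Lemma partialD (i : 'I_N) f g x : differentiable f x -> differentiable g x ->
  partial i (fun y => f y + g y) x = partial i f x + partial i g x.
Proof.
by move=> fx gx; rewrite /partial -deriveD //; apply: diff_derivable.
Qed.

Lemma partialN (i : 'I_N) f x : differentiable f x ->
  partial i (fun y => - f y) x = - partial i f x.
Proof. by move=> fx; rewrite /partial -deriveN //; apply: diff_derivable. Qed.

Lemma partialM (i : 'I_N) f g x : differentiable f x -> differentiable g x ->
  partial i (fun y => f y * g y) x = f x * partial i g x + g x * partial i f x.
Proof.
by move=> fx gx; rewrite /partial [LHS]deriveM //; apply: diff_derivable.
Qed.

(** The inverse square is spelled as a product of inverses, so that continuity of this derivative
    reduces to continuity of products. *)
Lemma partialV (i : 'I_N) f x : differentiable f x -> f x != 0 ->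
  partial i (fun y => (f y)^-1) x = - ((f x)^-1 * (f x)^-1 * partial i f x).
Proof.
move=> fx fx0; rewrite /partial deriveV //; last exact: diff_derivable.
by rewrite scaleNr expr2 invfM.
Qed.

(** Since [U] is open, [partial i f] and the explicit formula [df i] agree near each point of [U],
    so continuity passes from one to the other. Each closure property below thus only needs a
    formula for the partials. *)
Lemma C1_on_partial U f (df : 'I_N -> 'rV[R]_N -> R) : open U ->
  (forall x, U x -> differentiable f x) ->
  (forall i x, U x -> partial i f x = df i x) ->
  (forall i x, U x -> {for x, continuous (df i)}) -> C1_on U f.
Proof.
move=> oU fU fE dfU; split=> // i x Ux; rewrite /prop_for /continuous_at fE //.
have df_near : \forall y \near x, df i y = partial i f y.
  by apply: filterS (open_nbhs_nbhs (conj oU Ux)) => y Uy; rewrite fE.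
by apply: cvg_trans (dfU i x Ux); exact: near_eq_cvg df_near.
Qed.

Lemma C1_on_continuous U f x : C1_on U f -> U x -> {for x, continuous f}.
Proof. by case=> fU _ Ux; apply: differentiable_continuous; exact: fU. Qed.

Lemma C1_onD U f g : open U -> C1_on U f -> C1_on U g ->
  C1_on U (fun x => f x + g x).
Proof.
move=> oU [fU dfU] [gU dgU].
apply: (@C1_on_partial _ _ (fun i x => partial i f x + partial i g x)) => //.
- by move=> x Ux; apply: differentiableD; [exact: fU|exact: gU].
- by move=> i x Ux; apply: partialD; [exact: fU|exact: gU].
- by move=> i x Ux; exact: cvgD (dfU i x Ux) (dgU i x Ux).
Qed.

Lemma C1_onN U f : open U -> C1_on U f -> C1_on U (fun x => - f x).
Proof.
move=> oU [fU dfU].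
apply: (@C1_on_partial _ _ (fun i x => - partial i f x)) => //.
- by move=> x Ux; apply: differentiableN; exact: fU.
- by move=> i x Ux; apply: partialN; exact: fU.
- by move=> i x Ux; exact: cvgN (dfU i x Ux).
Qed.

Lemma C1_onM U f g : open U -> C1_on U f -> C1_on U g ->
  C1_on U (fun x => f x * g x).
Proof.
move=> oU fC1 gC1; have [[fU dfU] [gU dgU]] := (fC1, gC1).
apply: (@C1_on_partial _ _
  (fun i x => f x * partial i g x + g x * partial i f x)) => //.
- by move=> x Ux; apply: differentiableM; [exact: fU|exact: gU].
- by move=> i x Ux; apply: partialM; [exact: fU|exact: gU].
- move=> i x Ux; have fx := C1_on_continuous fC1 Ux.
  have gx := C1_on_continuous gC1 Ux.
  exact: cvgD (cvgM fx (dgU i x Ux)) (cvgM gx (dfU i x Ux)).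
Qed.

Lemma C1_onV U f : open U -> C1_on U f -> (forall x, U x -> f x != 0) ->
  C1_on U (fun x => (f x)^-1).
Proof.
move=> oU fC1 f0; have [fU dfU] := fC1.
apply: (@C1_on_partial _ _
  (fun i x => - ((f x)^-1 * (f x)^-1 * partial i f x))) => //.
- by move=> x Ux; apply: differentiableV; [exact: fU|exact: f0].
- by move=> i x Ux; apply: partialV; [exact: fU|exact: f0].
- move=> i x Ux; have fV : {for x, continuous (fun y => (f y)^-1)}.
    exact: cvgV (f0 x Ux) (C1_on_continuous fC1 Ux).
  exact: cvgN (cvgM (cvgM fV fV) (dfU i x Ux)).
Qed.

End RealC1.

Section ComplexC1.
Set Implicit Arguments.
Unset Strict Implicit.
Variables (R : realType) (N : nat).
Implicit Types (U : set 'rV[R]_N) (u v : 'rV[R]_N -> R[i]) (x : 'rV[R]_N).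

(** Real differentiability of both components, the pointwise part of [C1C_on]; no holomorphy is
    involved. *)
Definition differentiableC u x : Prop :=
  differentiable (fun y => complex.Re (u y)) x /\
  differentiable (fun y => complex.Im (u y)) x.

Lemma C1C_on_differentiable U u x : C1C_on U u -> U x -> differentiableC u x.
Proof. by move=> [[reu _] [imu _]] Ux; split; [exact: reu|exact: imu]. Qed.

(** The difference is written as a sum with an opposite, to match the rules for sums and opposites
    of real functions. *)
Lemma ReM (a b : R[i]) : complex.Re (a * b) =
  complex.Re a * complex.Re b + - (complex.Im a * complex.Im b).
Proof. by case: a b => [? ?] [? ?]. Qed.

Lemma ImM (a b : R[i]) : complex.Im (a * b) =
  complex.Re a * complex.Im b + complex.Im a * complex.Re b.
Proof. by case: a b => [? ?] [? ?]. Qed.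

Lemma C1C_onM U u v : open U -> C1C_on U u -> C1C_on U v ->
  C1C_on U (fun x => u x * v x).
Proof.
move=> oU [reu imu] [rev imv]; split.
- under eq_fun do rewrite ReM.
  exact: C1_onD oU (C1_onM oU reu rev) (C1_onN oU (C1_onM oU imu imv)).
- under eq_fun do rewrite ImM.
  exact: C1_onD oU (C1_onM oU reu imv) (C1_onM oU imu rev).
Qed.

Lemma C1C_onV U u : open U -> C1C_on U u -> (forall x, U x -> u x != 0) ->
  C1C_on U (fun x => (u x)^-1).
Proof.
move=> oU [reu imu] u0.
(* The squared modulus of [u]: the inverse of [u] is its conjugate divided by [n], which reduces the
   claim to inverting a real function. *)
pose n x := complex.Re (u x) * complex.Re (u x) +
            complex.Im (u x) * complex.Im (u x).
have nC1 : C1_on U n.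
    exact: C1_onD oU (C1_onM oU reu reu) (C1_onM oU imu imu).
have n0 x : U x -> n x != 0.
  move=> /u0; rewrite /n; case: (u x) => a b /=; rewrite eq_complex /=.
  by rewrite paddr_eq0 -?expr2 ?sqr_ge0 // !sqrf_eq0.
have nV : C1_on U (fun x => (n x)^-1) by exact: C1_onV oU nC1 n0.
(* This holds at every [x], even where [u] vanishes, because the inverse of 0 is 0; it can therefore
   be rewritten under the binder. *)
have uVE x : (u x)^-1 =
    (complex.Re (u x) * (n x)^-1) +i* (- (complex.Im (u x) * (n x)^-1)).
  by rewrite /n; case: (u x) => a b; rewrite -!expr2.
split.
- under eq_fun do rewrite uVE /=.
  exact: C1_onM oU reu nV.
- under eq_fun do rewrite uVE /=.
  exact: C1_onN oU (C1_onM oU imu nV).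
Qed.

Lemma cpartialM (i : 'I_N) u v x : differentiableC u x -> differentiableC v x ->
  cpartial i (fun y => u y * v y) x = u x * cpartial i v x + v x * cpartial i u x.
Proof.
move=> [reu imu] [rev imv]; rewrite /cpartial.
under [fun y => complex.Re (_ * _)]eq_fun do rewrite ReM.
under [fun y => complex.Im (_ * _)]eq_fun do rewrite ImM.
have M (f g : 'rV[R]_N -> R) : differentiable f x -> differentiable g x ->
    differentiable (fun y => f y * g y) x by exact: differentiableM.
rewrite partialD; [|exact: M|by apply: differentiableN; exact: M].
rewrite partialN; last exact: M.
rewrite partialD; [|exact: M|exact: M].
rewrite !partialM //.
case: (u x) (v x) => [a b] [c d] /=; apply/eqP; rewrite eq_complex /=.
by apply/andP; split; apply/eqP; ring.
Qed.

(** Derivatives are local. This is what allows using an identity between total functions that is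
    known only on [U]. *)
Lemma eq_cpartial (i : 'I_N) U u v x : open U -> U x ->
  (forall y, U y -> u y = v y) -> cpartial i u x = cpartial i v x.
Proof.
move=> oU Ux uv; have Unear := open_nbhs_nbhs (conj oU Ux).
by rewrite /cpartial /partial; congr (_ +i* _); apply: near_eq_derive;
  apply: filterS Unear => y Uy; rewrite uv.
Qed.

Variables (F : 'rV[R]_N -> R -> 'rV[R]_N) (t : R).

Lemma koopmanM u v x : differentiableC u x -> differentiableC v x ->
  koopman F t (fun y => u y * v y) x =
  u x * koopman F t v x + v x * koopman F t u x.
Proof.
move=> du dv; rewrite /koopman !mulr_sumr -big_split /=.
by apply: eq_bigr => i _; rewrite cpartialM //; ring.
Qed.

Lemma eq_koopman U u v x : open U -> U x ->
  (forall y, U y -> u y = v y) -> koopman F t u x = koopman F t v x.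
Proof.
by move=> oU Ux uv; apply: eq_bigr => i _; rewrite (eq_cpartial _ oU Ux uv).
Qed.

(** Leibniz rule applied to each product of a component of [F] with [u]. The sum is the divergence
    of [F] at time [t]; it does not depend on [u], so it can cancel between two eigenfunctions. *)
Lemma perron_frobeniusE u x :
  differentiable (fun y => F y t) x -> differentiableC u x ->
  perron_frobenius F t u x =
  - (u x * \sum_(i < N) cpartial i (fun y => (F y t 0 i)%:C) x
     + koopman F t u x).
Proof.
move=> dF du; rewrite /perron_frobenius /koopman mulr_sumr -big_split /=.
congr (- _); apply: eq_bigr => i _; rewrite cpartialM //; first by rewrite addrC.
(* A component of [F] is real: its imaginary part is the constant 0, and its real part is [F]
   followed by a coordinate projection. *)
split=> /=; last exact: differentiable_cst.
exact: (differentiable_comp dF (differentiable_coord _ _ _)).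
Qed.

End ComplexC1.

Theorem theorem2 (R : realType) (N : nat)
    (F : 'rV[R]_N -> R -> 'rV[R]_N)
    (F_C1 : forall t : R, C1_on [set: 'rV[R]_N] (fun x => F x t))
    (U : set 'rV[R]_N) (U_open : open U)
    (u1 u2 : 'rV[R]_N -> R[i]) (lambda1 lambda2 : R[i])
    (u1_eig : perron_frobenius_eigenfunction F U lambda1 u1)
    (u2_eig : perron_frobenius_eigenfunction F U lambda2 u2)
    (u1_neq0 : forall x, U x -> u1 x != 0) :
  koopman_eigenfunction F U (lambda1 - lambda2) (fun x => u2 x / u1 x).
Proof.
have [u1C1 _ u1P] := u1_eig; have [u2C1 [x0 Ux0 u2x0] u2P] := u2_eig.
have wC1 : C1C_on U (fun x => u2 x / u1 x).
  exact: C1C_onM U_open u2C1 (C1C_onV U_open u1C1 u1_neq0).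
(* The ratio is nonzero wherever [u2] is, in particular at [x0]. *)
split=> //; first by exists x0; rewrite // mulf_neq0 ?invr_neq0 ?u1_neq0.
move=> t x Ux.
have dF : differentiable (fun y => F y t) x by have [+ _] := F_C1 t; exact.
have d1 := C1C_on_differentiable u1C1 Ux.
have d2 := C1C_on_differentiable u2C1 Ux.
have dw := C1C_on_differentiable wC1 Ux.
have := u1P t x Ux; have := u2P t x Ux.
rewrite !perron_frobeniusE //.
have u2E y : U y -> u2 y = u2 y / u1 y * u1 y by move=> Uy; rewrite divfK ?u1_neq0.
rewrite (eq_koopman F t U_open Ux u2E) koopmanM // => P2 P1.
(* Every [u2 x] becomes the ratio times [u1 x]; [mulfK] restores the occurrences already divided by
   [u1 x]. *)
move: P2; rewrite (u2E x Ux) mulfK ?u1_neq0 //.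
set D := \sum_(i < N) _ in P1 *; set K1 := koopman F t u1 x in P1 *.
set Kw := koopman F t _ x; set w := u2 x / u1 x => P2.
apply: (mulfI (u1_neq0 x Ux)).
have -> : u1 x * Kw = - (lambda2 * (w * u1 x)) - w * u1 x * D - w * K1.
  by rewrite -P2; ring.
(* Substituting [K1] produces a second term in [w * u1 x * D], of opposite sign, which removes the
   divergence. *)
have -> : K1 = - (lambda1 * u1 x) - u1 x * D by rewrite -P1; ring.
ring.
Qed.
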